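(* Let $n\ge1$ be an integer. Among polynomials $P$ of degree at most $2n+1$, the endpoint data $$P(0)=0,\qquad P(1)=1,\qquad P^{(k)}(0)=P^{(k)}(1)=0\quad(1\le k\le n)$$ have the unique solution $P=F_n$, where $$F_n(x)=\frac{\int_0^x u^n(1-u)^n\,du}{\mathrm B(n+1,n+1)} .$$
   Context: $\mathrm B(a,b)=\int_0^1u^{a-1}(1-u)^{b-1}du$ is the Euler beta function, so $F_n(x)=I_x(n+1,n+1)$ is the regularized incomplete beta function. Polynomials have real coefficients and $P^{(k)}$ denotes the $k$-th derivative. *)

(* Defs.v *)
From HB Require Import structures.
From mathcomp Require Import all_boot all_order all_algebra.
From mathcomp Require Import all_classical all_reals all_analysis.

Set Implicit Arguments.
Unset Strict Implicit.
Unset Printing Implicit Defensive.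

Import Order.TTheory GRing.Theory Num.Theory.
Import numFieldNormedType.Exports.

Local Open Scope classical_set_scope.
Local Open Scope ring_scope.

(* [Rintegral] over `[a, b] is 0 when b < a, hence the case distinction: for
   b < a this is the usual - \int_b^a f. *)
Definition oriented_integral (R : realType) (a b : R) (f : R -> R) : R :=
  if a <= b then \int[lebesgue_measure]_(u in `[a, b]) f u
  else - \int[lebesgue_measure]_(u in `[b, a]) f u.

(* [beta_fun a b] is the integral over [0, 1] of u^(a-1) (1-u)^(b-1),
   for natural numbers a and b. *)
Definition F (R : realType) (n : nat) (x : R) : R :=
  oriented_integral 0 x (fun u => u ^+ n * (1 - u) ^+ n)
  / beta_fun n.+1 n.+1.

Definition endpoint_data (R : realType) (n : nat) (P : {poly R}) : Prop :=
  [/\ P.[0] = 0,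
      P.[1] = 1 &
      forall k : nat, (1 <= k <= n)%N -> P^`(k).[0] = 0 /\ P^`(k).[1] = 0].

(* Main.v *)
(* The integrand u^n (1-u)^n is a polynomial divisible by ('X - a)^n for
   a = 0 and a = 1, so its normalized antiderivative satisfies the endpoint
   data.  The difference of two solutions is divisible by ('X - 0)^(n+1) and
   ('X - 1)^(n+1), which are coprime, so it has degree at least 2n+2 or is 0. *)
Require Import Defs.
From mathcomp Require Import all_boot all_order all_algebra.
From mathcomp Require Import all_classical all_reals all_analysis.
From mathcomp Require Import zify.
Import Order.TTheory GRing.Theory Num.Theory.
Import numFieldNormedType.Exports.
Local Open Scope ring_scope.

(** Induction on [m]: differentiating a multiple of [('X - a%:P) ^+ m.+1] leaves a multiple of
    [('X - a%:P) ^+ m]. *)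
Lemma dvdp_XsubC_exp_derivn {R : fieldType} (p : {poly R}) (a : R) (m : nat) :
  ('X - a%:P) ^+ m %| p -> forall k, (k < m)%N -> p^`(k).[a] = 0.
Proof.
elim: m p => [|m IHm] p // /dvdpP [q ->] [|k] ltkm.
  by rewrite derivn0 hornerM horner_exp hornerXsubC subrr expr0n mulr0.
rewrite derivSn; apply: IHm => //.
rewrite derivM dvdp_add //; first by rewrite dvdp_mull // exprS dvdp_mull.
by rewrite deriv_exp derivXsubC mul1r mulrnAr -mulrnAl dvdp_mull.
Qed.

(** Read off from the Taylor expansion at [a]. Characteristic zero matters: the Taylor coefficient
    is the derivative divided by [i]!. *)
Lemma XsubC_exp_dvdp_derivn {R : numFieldType} (p : {poly R}) (a : R)
    (m : nat) :
  (forall k, (k < m)%N -> p^`(k).[a] = 0) -> ('X - a%:P) ^+ m %| p.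
Proof.
move=> p_eq0.
have -> : p = \sum_(i < size p) (p^`N(i).[a])%:P * ('X - a%:P) ^+ i.
  (* Writing ['X] as [a%:P + ('X - a%:P)] turns [p] composed with ['X] into a Taylor sum. *)
  rewrite -[LHS]comp_polyXr /comp_poly -[in LHS](subrKC a%:P 'X).
  rewrite (nderiv_taylor _ (mulrC _ _)) size_map_polyC.
  by apply: eq_bigr => i _; rewrite nderivn_map horner_map.
elim/big_ind: _ => [|x y|i _]; [exact: dvdp0|exact: dvdp_add|].
have [ltim|lemi] := ltnP i m; last by rewrite dvdp_mull // dvdp_exp2l.
have /eqP := p_eq0 _ ltim.
rewrite nderivn_def hornerMn mulrn_eq0 eqn0Ngt fact_gt0 /= => /eqP ->.
by rewrite mul0r dvdp0.
Qed.

(* The constant coefficient is [p`_0 / 0 = 0]. *)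
Definition antideriv {R : fieldType} (p : {poly R}) : {poly R} :=
  \poly_(i < (size p).+1) (p`_i.-1 / i%:R).

Lemma deriv_antideriv {R : numFieldType} (p : {poly R}) :
  (antideriv p)^`() = p.
Proof.
apply/polyP => i; rewrite coef_deriv coef_poly ltnS.
case: ltnP => [_|lepi]; last by rewrite mul0rn nth_default.
by rewrite -[LHS]mulr_natr divfK // pnatr_eq0.
Qed.

Lemma antideriv0 {R : fieldType} (p : {poly R}) : (antideriv p).[0] = 0.
Proof. by rewrite horner_coef0 coef_poly invr0 mulr0. Qed.

Lemma Rintegral_horner_deriv {R : realType} (q : {poly R}) (a b : R) :
  a <= b ->
  \int[lebesgue_measure]_(u in `[a, b]%classic) q^`().[u] = q.[b] - q.[a].
Proof.
(* The fundamental theorem is applied for [a < b] only; for [a = b] both sides are 0. *)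
rewrite le_eqVlt => /predU1P [->|ltab].
  by rewrite set_itv1 Rintegral_set1 subrr.
rewrite /Rintegral (continuous_FTC2 (F := horner q) ltab) //.
- by apply: continuous_subspaceT => x; exact: continuous_horner.
- split.
  + by move=> x _; apply: ex_derive; exact: is_derive_poly.
  + exact/cvg_at_right_filter/continuous_horner.
  + exact/cvg_at_left_filter/continuous_horner.
- by move=> x _; rewrite derivE.
Qed.

(** Dropping the order on the endpoints makes the formula available for [F n x] at negative [x]
    too. *)
Lemma oriented_integral_horner_deriv {R : realType} (q : {poly R}) (a b : R) :
  oriented_integral a b (horner q^`()) = q.[b] - q.[a].
Proof.
rewrite /oriented_integral; case: leP => [|/ltW] leab.
  exact: Rintegral_horner_deriv.
by rewrite Rintegral_horner_deriv // opprB.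
Qed.

(** Identifies the normalizing constant of [F] with the value at 1 of its numerator. *)
Lemma beta_fun_oriented_integral {R : realType} (m n : nat) :
  beta_fun m.+1 n.+1 =
    oriented_integral 0 1 (fun u : R => u ^+ m * (1 - u) ^+ n).
Proof. by rewrite /oriented_integral ler01 /beta_fun -Rintegral_mkcond. Qed.

Definition beta_poly (R : nzRingType) (n : nat) : {poly R} :=
  'X ^+ n * (1 - 'X) ^+ n.

Lemma horner_beta_poly {R : comNzRingType} (n : nat) (u : R) :
  (beta_poly R n).[u] = u ^+ n * (1 - u) ^+ n.
Proof. by rewrite /beta_poly !hornerE. Qed.

Lemma size_beta_poly {R : comNzRingType} (n : nat) :
  (size (beta_poly R n) <= (2 * n).+1)%N.
Proof.
apply: leq_trans (size_polyMleq _ _) _.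
rewrite size_polyXn addSn /= mul2n -addnn -addnS leq_add2l.
apply: leq_trans (size_poly_exp_leq _ _) _.
by rewrite -opprB size_polyN -polyC1 size_XsubC /= mul1n.
Qed.

Lemma beta_poly_dvdp0 (R : fieldType) (n : nat) :
  ('X - 0%:P) ^+ n %| beta_poly R n.
Proof. by rewrite subr0 dvdp_mulr. Qed.

Lemma beta_poly_dvdp1 (R : fieldType) (n : nat) :
  ('X - 1%:P) ^+ n %| beta_poly R n.
Proof. by rewrite dvdp_mull // dvdp_exp2r // -[1 - 'X]opprB dvdpNr. Qed.

Lemma endpoint_data_uniq {R : realType} (n : nat) (P Q : {poly R}) :
  (size P <= (2 * n + 1).+1)%N -> (size Q <= (2 * n + 1).+1)%N ->
  endpoint_data n P -> endpoint_data n Q -> Q = P.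
Proof.
move=> sP sQ [P0 P1 dP] [Q0 Q1 dQ].
apply/eqP; rewrite -subr_eq0; apply: contraT => PQ_neq0.
have dvd0 : ('X - 0%:P) ^+ n.+1 %| Q - P.
  (* Order 0 uses the prescribed values, orders 1 to [n] the vanishing derivatives. *)
  apply: XsubC_exp_dvdp_derivn => -[_|k ltkn].
    by rewrite derivn0 !hornerE Q0 P0 subrr.
  by rewrite derivnB !hornerE (dP k.+1 ltkn).1 (dQ k.+1 ltkn).1 subrr.
have dvd1 : ('X - 1%:P) ^+ n.+1 %| Q - P.
  apply: XsubC_exp_dvdp_derivn => -[_|k ltkn].
    by rewrite derivn0 !hornerE Q1 P1 subrr.
  by rewrite derivnB !hornerE (dP k.+1 ltkn).2 (dQ k.+1 ltkn).2 subrr.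
have copr : coprimep (('X - 0%:P : {poly R}) ^+ n.+1) (('X - 1%:P) ^+ n.+1).
  apply/coprimep_expl/coprimep_expr.
  by rewrite coprimep_XsubC root_XsubC oner_eq0.
have : ('X - 0%:P) ^+ n.+1 * ('X - 1%:P) ^+ n.+1 %| Q - P.
  by rewrite Gauss_dvdp // dvd0.
move=> /(dvdp_leq PQ_neq0).
(* The product has size (n+2) + (n+2) - 1 = 2n+3, while [Q - P] has size at most 2n+2. *)
rewrite size_Mmonic ?expf_neq0 ?polyXsubC_eq0 ?monic_exp ?monicXsubC //.
rewrite !size_exp_XsubC => /leq_trans/(_ (size_polyD _ _)).
rewrite size_polyN leq_max.
by case/orP => /leq_trans => [/(_ _ sQ)|/(_ _ sP)]; lia.
Qed.

(* [size P <= 2n+2] means that P has degree at most 2n+1. *)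
Theorem proposition6 (R : realType) (n : nat) (hn : (1 <= n)%N) :
  exists P : {poly R},
    [/\ forall x : R, P.[x] = F n x,
        (size P <= (2 * n + 1).+1)%N,
        endpoint_data n P &
        forall Q : {poly R}, (size Q <= (2 * n + 1).+1)%N ->
          endpoint_data n Q -> Q = P].
Proof.
set A := antideriv (beta_poly R n); set c := (beta_fun n.+1 n.+1)^-1 : R.
have integralE x : oriented_integral 0 x (fun u : R => u ^+ n * (1 - u) ^+ n)
    = A.[x].
  (* Since [A] vanishes at 0, its value at [x] is the increment from 0 to [x]. *)
  rewrite -[RHS]subr0 -[X in _ - X](antideriv0 (beta_poly R n)).
  rewrite -oriented_integral_horner_deriv deriv_antideriv.
  by congr oriented_integral; apply/funext => u; rewrite horner_beta_poly.
have A1 : A.[1] = c^-1 by rewrite -integralE -beta_fun_oriented_integral invrK.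
have c_neq0 : c != 0 by rewrite invr_eq0 gt_eqF // beta_fun_gt0.
have sP : (size (c *: A) <= (2 * n + 1).+1)%N.
  apply: leq_trans (size_scale_leq _ _) (leq_trans (size_poly _ _) _).
  by rewrite addn1 ltnS size_beta_poly.
have dP : endpoint_data n (c *: A).
  split; first by rewrite hornerZ antideriv0 mulr0.
    by rewrite hornerZ A1 mulfV.
  (* One derivative is spent on undoing [antideriv], so only orders [k < n] of [beta_poly] remain,
     and its zeros of order [n] suffice. *)
  case=> [//|k] ltkn; rewrite derivSn derivZ deriv_antideriv derivnZ.
  rewrite !hornerZ (dvdp_XsubC_exp_derivn _ _ _ (beta_poly_dvdp0 R n)) //.
  by rewrite (dvdp_XsubC_exp_derivn _ _ _ (beta_poly_dvdp1 R n)) // !mulr0.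
exists (c *: A); split => // [x|Q sQ dQ].
  by rewrite hornerZ /F integralE mulrC.
exact: endpoint_data_uniq dP dQ.
Qed.
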